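(* Let $A$ be a Banach algebra such that every continuous derivation from $A$ into $A^*$ is weakly compact. Then the following statements hold. (i) A bounded linear operator $D:A\to A^*$ is a cyclic derivation if and only if its second transpose $D^{**}:A^{**}\to A^{***}=(A^{**})^*$ is a cyclic derivation. (ii) If $A^{**}$ is cyclically weakly amenable, then $A$ is cyclically weakly amenable. (iii) Assume that $A$ is a unital, commutative Banach algebra. If $A^{**}$ is cyclically amenable, then $A$ is cyclically amenable.
   Context: For a Banach algebra $A$, the dual $A^*$ is an $A$-bimodule via $\langle F\cdot a,x\rangle=\langle F,ax\rangle$ and $\langle a\cdot F,x\rangle=\langle F,xa\rangle$. A linear operator $D:A\to A^*$ is a derivation if $D(ab)=D(a)\cdot b+a\cdot D(b)$ for all $a,b\in A$; it is cyclic if $\langle D(a),b\rangle+\langle D(b),a\rangle=0$ for all $a,b\in A$; an inner derivation is one of the form $\mathrm{ad}_F: a\mapsto F\cdot a-a\cdot F$ with $F\in A^*$. $A$ is cyclically weakly amenable if every continuous derivation $A\to A^*$ is cyclic; $A$ is cyclically amenable if every cyclic derivation $A\to A^*$ is inner. The second dual $A^{**}$ is a Banach algebra under the first Arens product, $\langle \Phi\Psi,f\rangle=\langle\Phi,\Psi f\rangle$, where $\langle\Psi f,a\rangle=\langle\Psi,f\cdot a\rangle$ for $\Phi,\Psi\in A^{**}$, $f\in A^*$, $a\in A$. *)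

(* Defs.v *)
From HB Require Import structures.
From mathcomp Require Import all_boot all_order all_algebra.
From mathcomp Require Import complex.
From mathcomp Require Import boolp classical_sets functions reals topology normedtype.

Set Implicit Arguments.
Unset Strict Implicit.
Unset Printing Implicit Defensive.

Import Order.TTheory GRing.Theory Num.Theory.
Import numFieldNormedType.Exports.

Local Open Scope classical_set_scope.
Local Open Scope ring_scope.

(* Real and complex Banach algebras are treated at once: the scalars are R or
   R[i]. *)
Definition scalar_field (R : realType) (cplx : bool) : numFieldType :=
  if cplx then (complex R : numFieldType) else (R : numFieldType).

Section scalar_facts.
Variable R : realType.

Local Notation cRe := (@complex.Re R).
Local Notation cIm := (@complex.Im R).

Lemma complex_supremums (A : set (complex R : numFieldType)) :
  A 0 -> (forall x, A x -> 0 <= x) -> ubound A !=set0 -> supremums A !=set0.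
Proof.
move=> A0 Age0 [u uA].
have real_of (z : complex R) : 0 <= z -> z = (cRe z)%:C%C.
  by case: z => a c; rewrite lecE /= => /andP[/eqP -> _].
pose B := [set cRe z | z in A].
have Bub : ubound B (cRe u).
  by move=> _ [z /uA + <-]; rewrite lecE => /andP[].
have Bsup : has_sup B by split; [exists (cRe 0), 0|exists (cRe u)].
exists (sup B)%:C%C; split => [z Az|v vA].
  rewrite (real_of _ (Age0 _ Az)) lecR.
  by apply: ub_le_sup; [exact: Bsup.2|exists z].
have v0 : 0 <= v by exact: vA.
rewrite (real_of _ v0) lecR; apply: ge_sup; first exact: Bsup.1.
by move=> _ [z /vA + <-]; rewrite lecE => /andP[].
Qed.

Lemma scalar_supremums (b : bool) (A : set (scalar_field R b)) :
  A 0 -> (forall x, A x -> 0 <= x) -> ubound A !=set0 -> supremums A !=set0.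
Proof.
case: b A => A; first exact: complex_supremums.
move=> A0 _ Aub; exists (sup A).
have As : has_sup A by split => //; exists 0.
by split; [exact: sup_upper_bound|move=> v vA; apply: ge_sup => //; exists 0].
Qed.

Lemma complex_cauchy_cvg (F : set_system (complex R : numFieldType)^o) :
  ProperFilter F -> cauchy F -> cvg F.
Proof.
move=> FF /cauchyP Fc.
have normE (z : complex R) : `|z| = (Num.sqrt (cRe z ^+ 2 + cIm z ^+ 2))%:C%C.
  by case: z.
have Re_le (z : complex R) : `|cRe z|%:C%C <= `|z|.
  by rewrite normE lecR -sqrtr_sqr ler_wsqrtr// lerDl sqr_ge0.
have Im_le (z : complex R) : `|cIm z|%:C%C <= `|z|.
  by rewrite normE lecR -sqrtr_sqr ler_wsqrtr// lerDr sqr_ge0.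
have le_ReIm (z : complex R) : `|z| <= (`|cRe z| + `|cIm z|)%:C%C.
  rewrite normE lecR -[leRHS]ger0_norm ?addr_ge0// -sqrtr_sqr ler_wsqrtr//.
  rewrite sqrrD !real_normK ?num_real// addrAC lerDl mulrn_wge0//.
  by rewrite mulr_ge0.
have cvgP (f : complex R -> R) : (forall x y, f (x - y) = f x - f y) ->
    (forall z, `|f z|%:C%C <= `|z|) -> cvg (f @ F).
  move=> fB fle; apply: R_complete; apply/cauchyP => e e0.
  have e0C : 0 < e%:C%C :> complex R by rewrite ltcR.
  have [x Fx] := Fc _ e0C; exists (f x).
  change (F (f @^-1` ball (f x) e)).
  apply: filterS Fx => y; rewrite /= -!ball_normE /= => xy.
  change (`|f x - f y| < e); rewrite -fB -ltcR.
  exact: le_lt_trans (fle _) xy.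
have /cvgrPdist_lt Rel := cvgP cRe ltac:(by case=> ? ? [? ?]) Re_le.
have /cvgrPdist_lt Iml := cvgP cIm ltac:(by case=> ? ? [? ?]) Im_le.
apply/cvg_ex; exists (Complex (lim (cRe @ F)) (lim (cIm @ F))).
apply/cvgrPdist_lt => e e0.
have eE : e = (cRe e)%:C%C.
  by case: e e0 => a c; rewrite ltcE /= => /andP[/eqP -> _].
have e2 : 0 < cRe e / 2 by rewrite divr_gt0// -ltcR -eE.
near=> z; rewrite (le_lt_trans (le_ReIm _))// eE ltcR [cRe e]splitr ltrD//.
- have -> : cRe (Complex (lim (cRe @ F)) (lim (cIm @ F)) - z) =
    lim (cRe @ F) - cRe z by case: (z).
  by near: z; exact: Rel.
- have -> : cIm (Complex (lim (cRe @ F)) (lim (cIm @ F)) - z) =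
    lim (cIm @ F) - cIm z by case: (z).
  by near: z; exact: Iml.
Unshelve. all: by end_near. Qed.

Lemma scalar_cauchy_cvg (b : bool) (F : set_system (scalar_field R b)^o) :
  ProperFilter F -> cauchy F -> cvg F.
Proof. by case: b F => F FF; [exact: complex_cauchy_cvg|exact: R_complete]. Qed.

End scalar_facts.

Section clin.
Variables (K : numFieldType) (V W : normedModType K).

Definition clin_pred : {pred V -> W} := mem [set f | linear f /\ continuous f].

(* The bounded (= continuous) linear operators from V to W. *)
Record clin := Clin { clin_fun :> V -> W; clinP : clin_fun \in clin_pred }.

HB.instance Definition _ := [isSub for clin_fun].
HB.instance Definition _ := [Choice of clin by <:].

Lemma clin_linear (f : clin) : linear f.
Proof. by have [] := set_mem (clinP f). Qed.

Lemma clin_continuous (f : clin) : continuous f.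
Proof. by have [] := set_mem (clinP f). Qed.

HB.instance Definition _ (f : clin) :=
  GRing.isLinear.Build K V W _ (clin_fun f) (clin_linear f).

Lemma clinE (f g : clin) : clin_fun f =1 g -> f = g.
Proof. by move=> fg; apply: val_inj; exact/funext. Qed.

Definition mk_clin (f : V -> W) (lf : linear f) (cf : continuous f) : clin :=
  Clin (mem_set (conj lf cf) : f \in clin_pred).

Lemma clin_submod_closed : submod_closed clin_pred.
Proof.
split=> [|a f g /set_mem[lf cf] /set_mem[lg cg]]; apply/mem_set; split.
- by move=> a x y /=; rewrite scaler0 addr0.
- by move=> x; exact: cvg_cst.
- move=> k x y.
  change (a *: f (k *: x + y) + g (k *: x + y) =
    k *: (a *: f x + g x) + (a *: f y + g y)).
  by rewrite lf lg !scalerDr addrACA !scalerA mulrC.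
- by move=> x; apply: cvgD; [apply: cvgZr; exact: cf|exact: cg].
Qed.

HB.instance Definition _ :=
  GRing.isSubmodClosed.Build K (V -> W) clin_pred clin_submod_closed.
HB.instance Definition _ := [SubChoice_isSubLmodule of clin by <:].

Lemma clin_bounded (f : clin) :
  exists2 M : K, 0 <= M & forall x, `|f x| <= M * `|x|.
Proof.
have : bounded_near f (nbhs 0).
  by apply: continuous_linear_bounded; exact: clin_continuous.
move=> /linear_boundedP/pinfty_ex_gt0[M M0 fM].
by exists M => //; exact: ltW.
Qed.

Lemma bounded_continuous (f : V -> W) (M : K) : 0 <= M ->
  linear f -> (forall x, `|f x| <= M * `|x|) -> continuous f.
Proof.
move=> M0 lf fM; pose g : {linear V -> W} := HB.pack f
  (GRing.isLinear.Build K V W _ f lf).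
apply: (@bounded_linear_continuous K V W g); apply/linear_boundedP.
near=> r => x; apply: (le_trans (fM x)); rewrite ler_wpM2r//.
by near: r; apply: nbhs_pinfty_ge; exact: ger0_real.
Unshelve. all: by end_near. Qed.

End clin.

Section opnorm.
Variables (R : realType) (b : bool).
Local Notation K := (scalar_field R b).
Variables (V W : normedModType K).
Implicit Types f g : clin V W.

(* R[i] is only partially ordered; the supremum nevertheless exists by
   opnorm_sup. *)
Definition opnorm f : K := supremum 0 [set `|f x| | x in [set x | `|x| <= 1]].

Lemma opnorm_sup f :
  supremums [set `|f x| | x in [set x | `|x| <= 1]] (opnorm f).
Proof.
rewrite /opnorm; set S := [set _ | _ in _].
have S0 : S 0 by exists 0; rewrite ?linear0 /= normr0.
have : supremums S !=set0.
  apply: scalar_supremums => // [_ [x _ <-]//|].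
  have [M M0 fM] := clin_bounded f.
  exists M => _ [x /= x1 <-]; apply: (le_trans (fM x)).
  by rewrite -[leRHS]mulr1 ler_wpM2l.
case=> s Ss; rewrite /supremum; case: ifPn => [/eqP SE|_].
  by move: S0; rewrite SE.
exact: (xgetPex 0 (ex_intro _ s Ss)).
Qed.

Lemma opnorm_ge f x : `|f x| <= opnorm f * `|x|.
Proof.
have [->|x0] := eqVneq x 0; first by rewrite linear0 !normr0 mulr0.
have nx0 : 0 < `|x| by rewrite normr_gt0.
rewrite -ler_pdivrMr// mulrC -[`|x|^-1]gtr0_norm ?invr_gt0// -normrZ -linearZ.
apply: (opnorm_sup f).1; exists (`|x|^-1 *: x) => //=.
by rewrite normrZ normfV normr_id mulVf ?gt_eqF.
Qed.

Lemma opnorm_le f (M : K) :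
  0 <= M -> (forall x, `|f x| <= M * `|x|) -> opnorm f <= M.
Proof.
move=> M0 fM; apply: (opnorm_sup f).2 => _ [x /= x1 <-].
by apply: (le_trans (fM x)); rewrite -[leRHS]mulr1 ler_wpM2l.
Qed.

Lemma opnorm_ge0 f : 0 <= opnorm f.
Proof. by apply: (opnorm_sup f).1; exists 0; rewrite ?linear0 /= normr0. Qed.

Lemma opnormD f g : opnorm (f + g) <= opnorm f + opnorm g.
Proof.
apply: opnorm_le => [|x]; first by rewrite addr_ge0 ?opnorm_ge0.
change (`|f x + g x| <= (opnorm f + opnorm g) * `|x|).
by rewrite mulrDl (le_trans (ler_normD _ _))// lerD ?opnorm_ge.
Qed.

Lemma opnormZ (a : K) f : opnorm (a *: f) = `|a| * opnorm f.
Proof.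
have leZ c h : opnorm (c *: h) <= `|c| * opnorm h.
  apply: opnorm_le => [|x]; first by rewrite mulr_ge0 ?opnorm_ge0.
  change (`|c *: h x| <= `|c| * opnorm h * `|x|).
  by rewrite normrZ -mulrA ler_wpM2l ?opnorm_ge.
apply/eqP; rewrite eq_le leZ /=; have [->|a0] := eqVneq a 0.
  by rewrite normr0 mul0r opnorm_ge0.
by rewrite -ler_pdivlMl ?normr_gt0// -normfV -[in leLHS](scalerK a0 f) leZ.
Qed.

Lemma opnorm0_eq0 f : opnorm f = 0 -> f = 0.
Proof.
move=> f0; apply: clinE => x; apply/eqP; rewrite -normr_le0.
by rewrite (le_trans (opnorm_ge f x))// f0 mul0r.
Qed.

HB.instance Definition _ :=
  Lmodule_isNormed.Build K (clin V W) opnormD opnormZ opnorm0_eq0.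

End opnorm.

Section dual.
Variables (R : realType) (b : bool).
Local Notation K := (scalar_field R b).

Definition dual (V : normedModType K) : Type := clin V K^o.

Variable V : normedModType K.

HB.instance Definition _ := NormedModule.copy (dual V) (clin V K^o).

Lemma dual_cauchy_cvg (F : set_system (dual V)) :
  ProperFilter F -> cauchy F -> cvg F.
Proof.
move=> FF /cauchyP Fc.
have evB (f g : dual V) x : `|f x - g x| <= `|f - g| * `|x|.
  exact: (opnorm_ge (f - g) x).
have evc x : cvg ((fun f : dual V => f x : K^o) @ F).
  apply: scalar_cauchy_cvg; apply/cauchyP => e e0.
  have x1 : 0 < `|x| + 1 by rewrite ltr_wpDl.
  have [f1 Ff1] := Fc (e / (`|x| + 1)) (divr_gt0 e0 x1).
  exists (f1 x); change (F ((fun f : dual V => f x) @^-1` ball (f1 x : K^o) e)).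
  apply: filterS Ff1 => f; rewrite /= -!ball_normE /= ltr_pdivlMr// => /le_lt_trans.
  apply; apply: (le_trans (evB _ _ _)).
  by rewrite ler_wpM2l// lerDl.
pose g x : K^o := lim ((fun f : dual V => f x : K^o) @ F).
have gP x : (fun f : dual V => f x : K^o) @ F --> g x by exact: evc.
have lg : linear g.
  move=> a x y; apply: (@cvg_lim K^o) => //.
  rewrite (_ : (fun f : dual V => _) =
    (fun f : dual V => a *: (f x : K^o) + (f y : K^o))); last first.
    by apply/funext => f; rewrite linearP.
  by apply: cvgD; [apply: cvgZr|]; exact: gP.
have key e (f1 : dual V) : F (ball f1 e) -> forall x, `|f1 x - g x| <= e * `|x|.
  move=> Ff1 x; apply/ler_addgt0Pr => d d0.
  have /cvgrPdist_lt/(_ d d0) Fd := gP x.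
  have [f []] := filter_ex (filterI Ff1 Fd).
  rewrite -ball_normE /= => f1f gf.
  rewrite (le_trans (ler_distD (f x) _ _))// lerD//; last first.
    by rewrite distrC ltW.
  by apply: (le_trans (evB _ _ _)); rewrite ler_wpM2r// ltW.
have [f1 Ff1] := Fc 1 ltr01.
have cg : continuous g.
  apply: (@bounded_continuous _ _ _ _ (`|f1| + 1)) => [|//|x].
    by rewrite addr_ge0.
  have -> : g x = f1 x - (f1 x - g x) by rewrite opprB addrC subrK.
  rewrite mulrDl (le_trans (ler_normB _ _))// lerD//; last exact: key.
  exact: opnorm_ge.
pose G : dual V := mk_clin lg cg.
apply/cvg_ex; exists G; apply/cvgrPdist_le => e e0.
have e2 : 0 < e / 2 by rewrite divr_gt0.
have [f2 Ff2] := Fc _ e2.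
apply: filterS (Ff2) => f; rewrite -ball_normE /= => f2f.
rewrite (le_trans (ler_distD f2 _ _))// [leRHS]splitr lerD//; last exact: ltW.
by apply: opnorm_le => [|x]; [exact: ltW|rewrite -normrN opprB; exact: key].
Qed.

HB.instance Definition _ := Uniform_isComplete.Build (dual V) dual_cauchy_cvg.

End dual.

(* Not necessarily unital, hence not built on the rings of ssralg. *)
HB.mixin Record isBanachAlgebra (K : numFieldType) A
    & CompleteNormedModule K A := {
  bmul : A -> A -> A;
  bmulA : associative bmul;
  bmulDl : left_distributive bmul +%R;
  bmulDr : right_distributive bmul +%R;
  bmulZl : forall (k : K) (a c : A), bmul (k *: a) c = k *: bmul a c;
  bmulZr : forall (k : K) (a c : A), bmul a (k *: c) = k *: bmul a c;
  bnormM : forall a c : A, `|bmul a c| <= `|a| * `|c|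
}.

#[short(type="banachAlgType")]
HB.structure Definition BanachAlgebra (K : numFieldType) :=
  {A of isBanachAlgebra K A & CompleteNormedModule K A}.

Notation "a ** c" := (bmul a c) (at level 40, left associativity) : ring_scope.

Section bounded_operators.
Variables (R : realType) (b : bool).
Local Notation K := (scalar_field R b).

Lemma dual_norm_le (V : normedModType K) (f : dual V) x : `|f x| <= `|f| * `|x|.
Proof. exact: opnorm_ge. Qed.

Lemma dual_normP (V : normedModType K) (f : dual V) (M : K) :
  0 <= M -> (forall x, `|f x| <= M * `|x|) -> `|f| <= M.
Proof. exact: opnorm_le. Qed.

Variables V W : normedModType K.

Definition bounded_clin (f : V -> W) (M : K) (M0 : 0 <= M) (lf : linear f)
    (fM : forall x, `|f x| <= M * `|x|) : clin V W :=
  mk_clin lf (bounded_continuous M0 lf fM).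

End bounded_operators.

Section transpose.
Variables (R : realType) (b : bool).
Local Notation K := (scalar_field R b).
Variables V W : normedModType K.
Variable T : clin V W.

Fact transpose_fun_linear (g : dual W) : linear (fun x => g (T x) : K^o).
Proof. by move=> k x y; rewrite !linearP. Qed.

Fact transpose_fun_continuous (g : dual W) :
  continuous (fun x => g (T x) : K^o).
Proof.
by move=> x; apply: continuous_comp; exact: clin_continuous.
Qed.

Definition transpose_fun (g : dual W) : dual V :=
  mk_clin (transpose_fun_linear g) (@transpose_fun_continuous g).

Fact transpose_linear : linear transpose_fun.
Proof. by move=> k g h; exact: clinE. Qed.

Fact transpose_bounded g : `|transpose_fun g| <= opnorm T * `|g|.
Proof.
apply: dual_normP => [|x]; first by rewrite mulr_ge0 ?opnorm_ge0.
rewrite (le_trans (dual_norm_le g _))// [leRHS]mulrAC [leRHS]mulrC ler_wpM2l//.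
exact: opnorm_ge.
Qed.

Definition transpose : clin (dual W) (dual V) :=
  bounded_clin (opnorm_ge0 T) transpose_linear transpose_bounded.

End transpose.

Section weak_compactness.
Variables (R : realType) (b : bool).
Local Notation K := (scalar_field R b).

(* The coarsest topology making every f : dual X continuous. *)
Definition weak_space (X : normedModType K) : Type :=
  initial_topology
    (fun x : X => (fun f : dual X => f x) : prod_topology (fun _ => K^o)).

HB.instance Definition _ (X : normedModType K) := Topological.copy (weak_space X)
  (initial_topology
    (fun x : X => (fun f : dual X => f x) : prod_topology (fun _ => K^o))).

(* precompact = with compact closure, here for the weak topology of W. *)
Definition weakly_compact (V W : normedModType K) (T : clin V W) :=
  precompact ([set T x | x in [set x | `|x| <= 1]] : set (weak_space W)).

End weak_compactness.

Section dual_module.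
Variables (R : realType) (b : bool).
Local Notation K := (scalar_field R b).
Variable A : banachAlgType K.
Implicit Types (F : dual A) (a x : A).

Fact ract_linear F a : linear (fun x => F (a ** x) : K^o).
Proof. by move=> k x y; rewrite bmulDr bmulZr linearP. Qed.

Fact ract_bounded F a x : `|F (a ** x)| <= `|F| * `|a| * `|x|.
Proof.
by rewrite (le_trans (dual_norm_le _ _))// -mulrA ler_wpM2l ?bnormM.
Qed.

(* The right action F . a; lact below is the left action a . F. *)
Definition ract F a : dual A :=
  bounded_clin (mulr_ge0 (normr_ge0 F) (normr_ge0 a))
    (ract_linear F a) (ract_bounded F a).

Fact lact_linear F a : linear (fun x => F (x ** a) : K^o).
Proof. by move=> k x y; rewrite bmulDl bmulZl linearP. Qed.

Fact lact_bounded F a x : `|F (x ** a)| <= `|F| * `|a| * `|x|.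
Proof.
rewrite (le_trans (dual_norm_le _ _))// -mulrA ler_wpM2l//.
by rewrite mulrC bnormM.
Qed.

Definition lact a F : dual A :=
  bounded_clin (mulr_ge0 (normr_ge0 F) (normr_ge0 a))
    (lact_linear F a) (lact_bounded F a).

End dual_module.

Section arens.
Variables (R : realType) (b : bool).
Local Notation K := (scalar_field R b).
Variable A : banachAlgType K.
Implicit Types (Phi Psi : dual (dual A)) (f : dual A) (a : A).

Lemma norm_ract f a : `|ract f a| <= `|f| * `|a|.
Proof. by apply: dual_normP; [rewrite mulr_ge0|exact: ract_bounded]. Qed.

Fact bidual_act_linear Psi f : linear (fun a => Psi (ract f a) : K^o).
Proof.
move=> k x y; rewrite -linearP; congr (Psi _); apply: clinE => z /=.
change (f ((k *: x + y) ** z) = k *: (f (x ** z) : K^o) + f (y ** z)).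
by rewrite bmulDl bmulZl linearP.
Qed.

Fact bidual_act_bounded Psi f a : `|Psi (ract f a)| <= `|Psi| * `|f| * `|a|.
Proof.
by rewrite (le_trans (dual_norm_le _ _))// -mulrA ler_wpM2l ?norm_ract.
Qed.

(* The functional Psi f on A that enters the first Arens product. *)
Definition bidual_act Psi f : dual A :=
  bounded_clin (mulr_ge0 (normr_ge0 Psi) (normr_ge0 f))
    (bidual_act_linear Psi f) (bidual_act_bounded Psi f).

Lemma norm_bidual_act Psi f : `|bidual_act Psi f| <= `|Psi| * `|f|.
Proof. by apply: dual_normP; [rewrite mulr_ge0|exact: bidual_act_bounded]. Qed.

Fact arens_linear Phi Psi : linear (fun f => Phi (bidual_act Psi f) : K^o).
Proof.
move=> k f g; rewrite -linearP; congr (Phi _); apply: clinE => a.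
change (Psi (ract (k *: f + g) a) = k *: (Psi (ract f a) : K^o) + Psi (ract g a)).
by rewrite -linearP; congr (Psi _); exact: clinE.
Qed.

Fact arens_bounded Phi Psi f :
  `|Phi (bidual_act Psi f)| <= `|Phi| * `|Psi| * `|f|.
Proof.
by rewrite (le_trans (dual_norm_le _ _))// -mulrA ler_wpM2l ?norm_bidual_act.
Qed.

(* The first Arens product; it is the product of the Banach algebra structure
   on dual (dual A) declared at the end of this section. *)
Definition arens Phi Psi : dual (dual A) :=
  bounded_clin (mulr_ge0 (normr_ge0 Phi) (normr_ge0 Psi))
    (arens_linear Phi Psi) (arens_bounded Phi Psi).

Fact arensA : associative arens.
Proof.
move=> Phi Psi Xi; apply: clinE => f; congr (Phi _); apply: clinE => a.
congr (Psi _); apply: clinE => x; congr (Xi _); apply: clinE => y.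
by congr (f _); rewrite bmulA.
Qed.

Fact arensDl : left_distributive arens +%R.
Proof. by move=> Phi Psi Xi; exact: clinE. Qed.

Fact arensDr : right_distributive arens +%R.
Proof.
move=> Phi Psi Xi; apply: clinE => f.
change (Phi (bidual_act (Psi + Xi) f) =
  Phi (bidual_act Psi f) + Phi (bidual_act Xi f)).
by rewrite -linearD; congr (Phi _); exact: clinE.
Qed.

Fact arensZl (k : K) Phi Psi : arens (k *: Phi) Psi = k *: arens Phi Psi.
Proof. exact: clinE. Qed.

Fact arensZr (k : K) Phi Psi : arens Phi (k *: Psi) = k *: arens Phi Psi.
Proof.
apply: clinE => f.
change (Phi (bidual_act (k *: Psi) f) = k *: (Phi (bidual_act Psi f) : K^o)).
by rewrite -linearZ; congr (Phi _); exact: clinE.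
Qed.

Fact arens_normM Phi Psi : `|arens Phi Psi| <= `|Phi| * `|Psi|.
Proof. by apply: dual_normP; [rewrite mulr_ge0|exact: arens_bounded]. Qed.

HB.instance Definition _ := isBanachAlgebra.Build K (dual (dual A))
  arensA arensDl arensDr arensZl arensZr arens_normM.

End arens.

Section derivations.
Variables (R : realType) (b : bool).
Local Notation K := (scalar_field R b).
Variable A : banachAlgType K.

Definition derivation (D : {linear A -> dual A}) :=
  forall a c, D (a ** c) = ract (D a) c + lact a (D c).

Definition cyclic_operator (D : {linear A -> dual A}) :=
  forall a c, D a c + D c a = 0.

Definition inner_derivation (D : {linear A -> dual A}) :=
  exists F : dual A, forall a, D a = ract F a - lact a F.

Definition cyclically_weakly_amenable :=
  forall D : clin A (dual A), derivation D -> cyclic_operator D.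

(* Continuity of D is not required here. *)
Definition cyclically_amenable :=
  forall D : {linear A -> dual A},
    derivation D -> cyclic_operator D -> inner_derivation D.

Definition unital := exists e : A, forall a, e ** a = a /\ a ** e = a.

Definition commutative_alg := commutative (@bmul K A).

End derivations.

(* Main.v *)
Require Import Defs.
From HB Require Import structures.
From mathcomp Require Import all_boot all_order all_algebra.
From mathcomp Require Import complex ring lra.
From mathcomp Require Import boolp classical_sets functions reals topology normedtype.

Set Implicit Arguments.
Unset Strict Implicit.
Unset Printing Implicit Defensive.

Import Order.TTheory GRing.Theory Num.Theory.
Import numFieldNormedType.Exports.

Local Open Scope classical_set_scope.
Local Open Scope ring_scope.

(* The transpose D* of a weakly compact D : A -> A* satisfies Psi (D* Xi) =
   Xi g for some g in A* depending only on Psi (Gantmacher), so limits along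
   Psi may be exchanged with Xi.  If D is moreover a derivation, then
   a . Db = D(ab) - Da . b, so the same exchange shows that the two Arens
   products agree on every Db, hence on g, and this is the only obstruction
   to D** being a derivation.  A cyclic derivation is continuous by uniform
   boundedness, |Da(c)| = |Dc(a)|, so in (iii) D** is inner; evaluated at
   elements of the commutative algebra A, an inner derivation vanishes. *)

(** * Real parts, conjugates and real scalars, in the real and complex cases alike *)

Section scalars.
Variable R : realType.

Definition sre (b : bool) : scalar_field R b -> R :=
  match b return scalar_field R b -> R with
  | true => @complex.Re R | false => id end.

Definition sconj (b : bool) : scalar_field R b -> scalar_field R b :=
  match b return scalar_field R b -> scalar_field R b with
  | true => @conjc R | false => id end.

Definition sinj (b : bool) : R -> scalar_field R b :=
  match b return R -> scalar_field R b with
  | true => fun x => x%:C%C | false => id end.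

Variable b : bool.
Local Notation K := (scalar_field R b).
Implicit Types x y : K.

Lemma sre_is_additive : zmod_morphism (@sre b).
Proof. by case: b => // -[? ?] [? ?]. Qed.
HB.instance Definition _ :=
  GRing.isZmodMorphism.Build K R (@sre b) sre_is_additive.

Lemma sinjK : cancel (sinj b) (@sre b).
Proof. by case: b. Qed.

Lemma ler_sre x y : x <= y -> sre x <= sre y.
Proof. by case: b x y => // -[? ?] [? ?]; rewrite lecE /= => /andP[]. Qed.

(** The order of [R[i]] makes nonnegative elements real, so norms can be compared in the totally
    ordered [R]. *)
Lemma sinj_sre x : 0 <= x -> sinj b (sre x) = x.
Proof. by case: b x => //= -[x y]; rewrite lecE /= => /andP[/eqP ->]. Qed.

Lemma ler_sinj (s t : R) : (sinj b s <= sinj b t) = (s <= t).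
Proof. by case: b => //=; rewrite lecR. Qed.

Lemma sre_norm_ge0 (V : normedModType K) (v : V) : 0 <= sre `|v|.
Proof. by have := ler_sre (normr_ge0 v); rewrite raddf0. Qed.

Lemma sre_le_norm x : sre x <= sre `|x|.
Proof.
case: b x => [[x y]|x] /=; last exact: ler_norm.
apply: (le_trans (ler_norm _)).
by rewrite -sqrtr_sqr ler_wsqrtr// lerDl sqr_ge0.
Qed.

Lemma sre_conjM x : sre (sconj x * x) = sre `|x| ^+ 2.
Proof.
case: b x => [[x y]|x] /=; last by rewrite -expr2 real_normK// num_real.
by rewrite sqr_sqrtr ?addr_ge0 ?sqr_ge0//; ring.
Qed.

(** The linear and quadratic coefficients in [t] become the slope and the curvature in
    [dist_descent]. *)
Lemma sre_norm_sqrB x y (t : R) :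
  sre `|x - sinj b t * y| ^+ 2 =
  sre `|x| ^+ 2 - t *+ 2 * sre (sconj x * y) + t ^+ 2 * sre `|y| ^+ 2.
Proof.
rewrite -!sre_conjM; case: b x y => [[x1 x2] [y1 y2]|x y] /=; ring.
Qed.

Lemma sinj_nat (n : nat) : sinj b n%:R = n%:R.
Proof. by case: b => //=; rewrite rmorph_nat. Qed.

Lemma scalar_archi x : 0 <= x -> exists n : nat, x < n%:R.
Proof.
move=> x0; exists (Num.truncn (sre x)).+1.
rewrite -sinj_nat -{1}(sinj_sre x0) lt_neqAle ler_sinj.
by rewrite ltW ?truncnS_gt// andbT (inj_eq (can_inj sinjK)) lt_eqF ?truncnS_gt.
Qed.

Lemma sinjB (s t : R) : sinj b (s - t) = sinj b s - sinj b t.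
Proof. by case: b => //=; rewrite rmorphB. Qed.

Lemma norm_sinj (t : R) : 0 <= t -> `|sinj b t| = sinj b t.
Proof. by move=> t0; rewrite ger0_norm// -[0](sinj_nat 0) ler_sinj. Qed.

Lemma sinj1 : sinj b 1 = 1.
Proof. exact: (sinj_nat 1). Qed.

End scalars.

(** * Goldstine's theorem, by gradient descent *)

Section goldstine.
Variables (R : realType) (b : bool).
Local Notation K := (scalar_field R b).
Variable V : normedModType K.

(** The norm is the supremum of [|h v|] over the unit ball; rotating [v] by the phase of [h v]
    replaces the modulus by the real part. *)
Lemma dual_norming (h : dual V) (e : R) : 0 < e ->
  exists2 v, `|v| <= 1 & sre `|h| - e <= sre (h v).
Proof.
move=> e0; apply: contrapT => hn.
have hle v : `|v| <= 1 -> sre `|h v| < sre `|h| - e.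
  move=> v1; rewrite ltNge; apply/negP => hv; apply: hn.
  have [hv0|hv0] := eqVneq (h v) 0.
    by exists v; rewrite // hv0 normr0 in hv *.
  exists ((`|h v| / h v) *: v).
    by rewrite normrZ normf_div normr_id divff ?normr_eq0// mul1r.
  by rewrite linearZ /= -[_ *: _]/(_ * _) divfK.
have s0 : 0 <= sre `|h| - e.
  by apply: (le_trans (sre_norm_ge0 (h 0))); apply/ltW/hle; rewrite normr0.
have : `|h| <= sinj b (sre `|h| - e).
  apply: (opnorm_sup h).2 => _ [v /= v1 <-].
  by rewrite -(sinj_sre (normr_ge0 (h v))) ler_sinj ltW// hle.
move/ler_sre; rewrite sinjK; lra.
Qed.

Lemma dual_sumE I (r : seq I) (F : I -> dual V) v :
  (\sum_(i <- r) F i) v = \sum_(i <- r) F i v.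
Proof. exact: (big_morph (fun f : dual V => f v)). Qed.

Variable Psi : dual (dual V).
Hypothesis Psi1 : `|Psi| <= 1.
Variable s : seq (dual V).

(** Squared moduli make [dist] quadratic along segments, hence open to a descent step. *)
Let dist (v : V) : R := \sum_(f <- s) sre `|Psi f - f v| ^+ 2.

Let C : R := \sum_(f <- s) sre `|f| ^+ 2.

(* Moving v towards a u that almost norms h = \sum_f conj (Psi f - f v) f: since
   |Psi h| <= |h|, the slope Re h(u - v) is at least dist v - 1/2. *)
Let dist_descent v : `|v| <= 1 -> 1 <= dist v ->
  exists2 w, `|w| <= 1 & dist w <= dist v - (4 * (C *+ 4 + 1))^-1.
Proof.
move=> v1 dv1.
have C0 : 0 <= C by apply: sumr_ge0 => f _; exact: sqr_ge0.
pose c f := sconj (Psi f - f v).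
pose h : dual V := \sum_(f <- s) c f *: f.
have [u u1 hu] := dual_norming h (ltac:(lra) : 0 < 2^-1 :> R).
have hE x : h x = \sum_(f <- s) c f * f x by rewrite dual_sumE.
have PhE : Psi h = \sum_(f <- s) c f * Psi f.
  by rewrite linear_sum; apply: eq_bigr => f _; rewrite linearZ.
have gap : sre (Psi h) - sre (h v) = dist v.
  rewrite -raddfB PhE hE -sumrB raddf_sum; apply: eq_bigr => f _.
  by rewrite -mulrBr -sre_conjM.
have Phh : sre (Psi h) <= sre `|h|.
  rewrite (le_trans (sre_le_norm _))//; apply: ler_sre.
  by rewrite (le_trans (dual_norm_le _ _))// -[leRHS]mul1r ler_wpM2r.
(* With slope at least 1/2 and curvature at most [4 C], this step decreases [dist] by at least
   [t - 4 C t^2 = t/2 + t^2]. The added 1 covers [C = 0] and keeps [t <= 1], so the new point is a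
   convex combination of [u] and [v]. *)
pose t : R := (2 * (C *+ 4 + 1))^-1.
have D0 : 0 < C *+ 4 + 1 by rewrite ltr_wpDl// mulrn_wge0.
have t0 : 0 < t by rewrite invr_gt0 mulr_gt0.
have tD : t * (C *+ 4 + 1) = 2^-1 by rewrite /t invfM mulfVK ?gt_eqF.
have t1 : t <= 1 by nra.
have -> : (4 * (C *+ 4 + 1))^-1 = t / 2.
  by rewrite /t -invfM; congr (_^-1); ring.
exists (v + sinj b t *: (u - v)).
  rewrite [X in `|X|](_ : _ = sinj b (1 - t) *: v + sinj b t *: u); last first.
    by rewrite sinjB sinj1 scalerBl scalerBr scale1r addrCA addrC.
  have t1' : 0 <= 1 - t by rewrite subr_ge0.
  rewrite (le_trans (ler_normD _ _))// !normrZ !norm_sinj ?(ltW t0)//.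
  have <- : sinj b (1 - t) + sinj b t = 1 by rewrite sinjB sinj1 subrK.
  rewrite lerD// -[leRHS]mulr1 ler_wpM2l// -[0](sinj_nat R b 0) ler_sinj//.
  exact: ltW.
have -> : dist (v + sinj b t *: (u - v)) = dist v -
    t *+ 2 * (sre (h u) - sre (h v)) +
    t ^+ 2 * \sum_(f <- s) sre `|f u - f v| ^+ 2.
  rewrite -raddfB !hE -sumrB raddf_sum !mulr_sumr -sumrB -big_split.
  apply: eq_bigr => f _; rewrite /= -mulrBr -sre_norm_sqrB.
  congr (sre `|_| ^+ 2).
  by rewrite linearD linearZ linearB /= opprD addrA.
have : \sum_(f <- s) sre `|f u - f v| ^+ 2 <= C *+ 4.
  rewrite -sumrMnl ler_sum// => f _.
  have : sre `|f u - f v| <= sre `|f| *+ 2.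
    rewrite -raddfMn; apply: ler_sre; rewrite (le_trans (ler_normB _ _))//.
    rewrite mulr2n lerD// (le_trans (dual_norm_le _ _))//.
      by rewrite -[leRHS]mulr1 ler_wpM2l.
    by rewrite -[leRHS]mulr1 ler_wpM2l.
  have := sre_norm_ge0 (f u - f v); have := sre_norm_ge0 f.
  nra.
move: (\sum_(f <- s) _) => E EC.
have h12 : 2^-1 <= sre (h u) - sre (h v) by lra.
have : t ^+ 2 * E <= t ^+ 2 * (C *+ 4) by rewrite ler_wpM2l ?sqr_ge0.
have : t ^+ 2 * (C *+ 4) = t / 2 - t ^+ 2.
  by rewrite -tD; ring.
have : t * 2^-1 <= t * (sre (h u) - sre (h v)) by rewrite ler_wpM2l// ltW.
have := sqr_ge0 t.
rewrite mulrnAl; lra.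
Qed.

(** If every [v] of the unit ball failed, [dist] would stay at least 1 there, while [dist_descent]
    lowers it by a fixed amount at each step. *)
Lemma goldstine :
  exists2 v, `|v| <= 1 & forall f, f \in s -> `|Psi f - f v| < 1.
Proof.
apply: contrapT => hn.
have far v : `|v| <= 1 -> 1 <= dist v.
  move=> v1; rewrite leNgt; apply/negP => dv; apply: hn; exists v => // f fs.
  have : sre `|Psi f - f v| ^+ 2 < 1.
    apply: le_lt_trans dv; rewrite /dist (big_rem f fs) /= lerDl.
    by apply: sumr_ge0 => g _; exact: sqr_ge0.
  rewrite -[X in _ < X](expr1n _ 2) ltr_pXn2r ?nnegrE ?sre_norm_ge0//.
  rewrite !lt_neqAle => /andP[/negP n1 l1]; apply/andP; split.
    by apply/negP => /eqP E; apply: n1; rewrite E -sinj1 sinjK.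
  by rewrite -(sinj_sre (normr_ge0 _)) -sinj1 ler_sinj.
pose e : R := (4 * (C *+ 4 + 1))^-1.
have e0 : 0 < e.
  rewrite invr_gt0 mulr_gt0// ltr_wpDl// mulrn_wge0// sumr_ge0// => f _.
  exact: sqr_ge0.
have desc n : exists2 v, `|v| <= 1 & dist v <= dist 0 - e *+ n.
  elim: n => [|n [v v1 dv]].
    by exists 0; rewrite ?normr0 ?ler01// mulr0n subr0.
  have [w w1 dw] := dist_descent v1 (far _ v1); exists w => //.
  by apply: (le_trans dw); rewrite [e *+ _]mulrSr opprD addrA lerB.
have [v v1 dv] := desc (Num.truncn (dist 0 / e)).+1.
have := far _ v1; have := truncnS_gt (dist 0 / e).
rewrite ltr_pdivrMr// mulr_natl; lra.
Qed.

End goldstine.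

(** * The canonical embedding into the second dual *)

Section bidual_embedding.
Variables (R : realType) (b : bool).
Local Notation K := (scalar_field R b).
Variable V : normedModType K.

Fact to_bidual_linear (v : V) : linear (fun f : dual V => f v : K^o).
Proof. by []. Qed.

Fact to_bidual_bounded (v : V) (f : dual V) : `|f v| <= `|v| * `|f|.
Proof. by rewrite mulrC dual_norm_le. Qed.

Definition to_bidual (v : V) : dual (dual V) :=
  bounded_clin (normr_ge0 v) (to_bidual_linear v) (to_bidual_bounded v).

End bidual_embedding.

(** * Gantmacher's theorem: second transposes of weakly compact operators *)

Section gantmacher.
Variables (R : realType) (b : bool).
Local Notation K := (scalar_field R b).
Variables V W : normedModType K.

Lemma weak_continuous (f : dual W) : continuous (f : weak_space W -> K^o).
Proof.
move=> x; apply: (@continuous_comp (weak_space W)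
  (prod_topology (fun _ : dual W => K^o)) K^o
  (fun w g => g w) (fun h => h f)).
  exact: initial_continuous.
exact: (@proj_continuous (dual W) (fun _ => K^o) f).
Qed.

(** Were [f w] nonzero, a multiple of [w] would be sent exactly to [M]. *)
Lemma dual_bounded_eq0 (X : normedModType K) (f : dual X) (M : K) :
  (forall x, `|f x| < M) -> f = 0.
Proof.
move=> fM; apply: clinE => w; have [->|fw0] := eqVneq (f w) 0; first by [].
have M0 : 0 <= M by apply: ltW; apply: le_lt_trans (fM 0).
have := fM ((M / f w) *: w); rewrite linearZ /= -[_ *: _]/(_ * _) divfK//.
by rewrite ger0_norm// ltxx.
Qed.

(** [Psi] is a weak-star limit of points [v] of the unit ball; the images [T v] cluster weakly at
    some [w], which represents the second transpose of [T] at [Psi]. *)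
Lemma weakly_compact_bidual_unit (T : clin V W) (Psi : dual (dual V)) :
  weakly_compact T -> `|Psi| <= 1 ->
  exists w, forall Xi : dual W, Psi (transpose T Xi) = Xi w.
Proof.
rewrite /weakly_compact precompactE => Tc Psi1.
(* Basic weak-star neighbourhoods of [Psi], cut down to the unit ball. Radius 1 suffices, since
   [dual_bounded_eq0] turns a uniform bound into equality. *)
pose B (s : seq (dual V)) :=
  [set v | `|v| <= 1 /\ forall f, f \in s -> `|Psi f - f v| < 1].
pose G := filter_from [set: seq (dual V)] B.
have GF : ProperFilter G.
  apply: filter_from_proper => [|s _].
    apply: filter_from_filter => [|s t _ _]; first by exists [::].
    exists (s ++ t) => // v [v1 sv].
    by split; split => // f fs; apply: sv; rewrite mem_cat fs ?orbT.
  by have [v v1 sv] := goldstine Psi1 s; exists v.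
pose F : set_system (weak_space W) := (T : V -> weak_space W) @ G.
have [|w [_ Fw]] := Tc F _.
  exists [::] => // v [v1 _]; apply: subset_closure; by exists v.
suff /eqP : transpose (transpose T) Psi - to_bidual w = 0.
  rewrite subr_eq0 => /eqP TPsi; exists w => Xi.
  by rewrite -[RHS]/(to_bidual w Xi) -TPsi.
(* An error below 1 comes from replacing [Psi] by [v], another from replacing [T v] by [w]; neither
   bound depends on [Xi]. *)
apply: (dual_bounded_eq0 (M := 2)) => Xi.
have FX : F [set T v | v in B [:: transpose T Xi]].
  by exists [:: transpose T Xi] => // v Bv; exists v.
have : nbhs (w : weak_space W)
    ((Xi : weak_space W -> K^o) @^-1` ball (Xi w : K^o) 1).
  by apply: weak_continuous; exact: nbhsx_ballx.
move=> /(Fw _ _ FX)[_ [[v [v1 Bv] <-]]]; rewrite /= -ball_normE /= => XiTv.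
change (`|Psi (transpose T Xi) - Xi w| < 2).
rewrite (le_lt_trans (ler_distD (Xi (T v)) _ _))// (natrD _ 1 1) ltrD//.
  by apply: Bv; rewrite inE.
by rewrite distrC.
Qed.

Lemma weakly_compact_bidual (T : clin V W) : weakly_compact T ->
  forall Psi : dual (dual V), exists w,
    forall Xi : dual W, Psi (transpose T Xi) = Xi w.
Proof.
(* Normalising by [|Psi| + 1] instead of [|Psi|] also covers [Psi = 0]. *)
move=> Tc Psi; have n0 : `|Psi| + 1 != 0 by rewrite gt_eqF// ltr_wpDl.
have [|w wE] := @weakly_compact_bidual_unit T ((`|Psi| + 1)^-1 *: Psi) Tc.
  rewrite normrZ normfV ger0_norm ?addr_ge0// mulrC ler_pdivrMr ?ltr_wpDl//.
  by rewrite mul1r lerDl.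
exists ((`|Psi| + 1) *: w) => Xi; rewrite linearZ /= -wE.
change (Psi (transpose T Xi) =
  (`|Psi| + 1) * ((`|Psi| + 1)^-1 * Psi (transpose T Xi))).
by rewrite mulVKf.
Qed.

End gantmacher.

(** * The second Arens product and second transposes of derivations *)

Section second_arens.
Variables (R : realType) (b : bool).
Local Notation K := (scalar_field R b).
Variable A : banachAlgType K.
Implicit Types (Phi Psi Xi : dual (dual A)) (f : dual A).

Fact bidual_ract_linear Xi f : linear (fun a => Xi (lact a f) : K^o).
Proof.
move=> k x y; rewrite -linearP; congr (Xi _); apply: clinE => z /=.
change (f (z ** (k *: x + y)) = k *: (f (z ** x) : K^o) + f (z ** y)).
by rewrite bmulDr bmulZr linearP.
Qed.

Fact bidual_ract_bounded Xi f a : `|Xi (lact a f)| <= `|Xi| * `|f| * `|a|.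
Proof.
rewrite (le_trans (dual_norm_le _ _))// -mulrA ler_wpM2l//.
by apply: dual_normP; [rewrite mulr_ge0|exact: lact_bounded].
Qed.

(** The functional f . Xi that enters the second Arens product, the mirror image of [bidual_act]. *)
Definition bidual_ract Xi f : dual A :=
  bounded_clin (mulr_ge0 (normr_ge0 Xi) (normr_ge0 f))
    (bidual_ract_linear Xi f) (bidual_ract_bounded Xi f).

Fact arens2_linear Phi Xi : linear (fun f => Phi (bidual_ract Xi f) : K^o).
Proof.
move=> k f g; rewrite -linearP; congr (Phi _); apply: clinE => a.
change (Xi (lact a (k *: f + g)) = k *: (Xi (lact a f) : K^o) + Xi (lact a g)).
by rewrite -linearP; congr (Xi _); exact: clinE.
Qed.

Fact arens2_bounded Phi Xi f :
  `|Phi (bidual_ract Xi f)| <= `|Phi| * `|Xi| * `|f|.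
Proof.
rewrite (le_trans (dual_norm_le _ _))// -mulrA ler_wpM2l//.
by apply: dual_normP; [rewrite mulr_ge0|exact: bidual_ract_bounded].
Qed.

(* The second Arens product of Xi and Phi. *)
Definition arens2 Xi Phi : dual (dual A) :=
  bounded_clin (mulr_ge0 (normr_ge0 Phi) (normr_ge0 Xi))
    (arens2_linear Phi Xi) (arens2_bounded Phi Xi).

Lemma to_bidualM (a c : A) :
  to_bidual a ** to_bidual c = to_bidual (a ** c).
Proof. exact: clinE. Qed.

Variable D : clin A (dual A).
Local Notation D' := (transpose D).
Local Notation D'' := (transpose D').

Lemma bitranspose_to_bidual (a c : A) :
  D'' (to_bidual a) (to_bidual c) = D a c.
Proof. by []. Qed.

(** On canonical images [D''] restricts to [D] and the Arens product to the product of [A]. *)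
Lemma derivation_bitranspose_inv : derivation D'' -> derivation D.
Proof.
move=> dD a c; apply: clinE => x.
rewrite -bitranspose_to_bidual -to_bidualM dD.
change (D'' (to_bidual a) (to_bidual c ** to_bidual x) +
  D'' (to_bidual c) (to_bidual x ** to_bidual a) =
  D a (c ** x) + D c (x ** a)).
by rewrite !to_bidualM.
Qed.

Lemma cyclic_bitranspose_inv : cyclic_operator D'' -> cyclic_operator D.
Proof. by move=> cD a c; exact: (cD (to_bidual a) (to_bidual c)). Qed.

Hypotheses (dD : derivation D) (wD : weakly_compact D).

(** Both sides equal [Xi (l - ract k c)], where [k] and [l] represent [D''] at [Phi] and at
    [Phi ** to_bidual c]: apply [Phi], as a functional in [a], to
    [lact a (D c) = D (a ** c) - ract (D a) c]. *)
Lemma arens_regular_range Xi Phi c : arens2 Xi Phi (D c) = (Xi ** Phi) (D c).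
Proof.
have [k kE] := weakly_compact_bidual wD Phi.
have [l lE] := weakly_compact_bidual wD (Phi ** to_bidual c).
have -> : arens2 Xi Phi (D c) = Xi l - Xi (ract k c).
  rewrite -lE.
  change (Xi (ract k c)) with ((to_bidual c ** Xi) k); rewrite -kE.
  change ((Phi ** to_bidual c) (D' Xi)) with
    (Phi (bidual_act (to_bidual c) (D' Xi))).
  rewrite -linearB; congr (Phi _); apply: clinE => a.
  change (Xi (lact a (D c)) = Xi (D (a ** c)) - Xi (ract (D a) c)).
  by rewrite dD linearD addrC addKr.
(* What remains is [l - ract k c = bidual_act Phi (D c)], checked at each [x]. *)
rewrite -linearB; congr (Xi _); apply: clinE => x.
change (to_bidual x l - to_bidual (c ** x) k = Phi (ract (D c) x)).
rewrite -lE -kE.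
change ((Phi ** to_bidual c) (D' (to_bidual x))) with
  (Phi (bidual_act (to_bidual c) (D' (to_bidual x)))).
rewrite -linearB; congr (Phi _); apply: clinE => a.
change (D (a ** c) x - D a (c ** x) = D c (x ** a)).
by rewrite dD -[in LHS]/(D a (c ** x) + D c (x ** a)) addrC addKr.
Qed.

Lemma derivation_bitranspose : derivation D''.
Proof.
move=> Phi Psi; apply: clinE => Xi.
have [g gE] := weakly_compact_bidual wD Psi.
(* By [gE] the difference at [g] is [Psi] applied to [D'] of the difference of the two products, and
   that vanishes by [arens_regular_range]. *)
have regular : arens2 Xi Phi g = (Xi ** Phi) g.
  apply/eqP; rewrite -subr_eq0 -[_ - _]/((arens2 Xi Phi - Xi ** Phi) g) -gE.
  rewrite (_ : D' _ = 0) ?linear0//; apply: clinE => c.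
  rewrite -[LHS]/(arens2 Xi Phi (D c) - (Xi ** Phi) (D c)).
  by rewrite arens_regular_range subrr.
change (Phi (bidual_act Psi (D' Xi)) =
  Phi (D' (Psi ** Xi)) + Psi (D' (Xi ** Phi))).
(* Passing to the second product puts [Phi] outermost in all three terms, so that it can be
   stripped. *)
rewrite gE -regular -[arens2 _ _ _]/(Phi (bidual_ract Xi g)) -linearD.
congr (Phi _); apply: clinE => a.
(* This rewrites the last term as an Arens product evaluated at [g], where [gE] brings [Psi]
   outermost. *)
have lactE f : lact a f = bidual_act (to_bidual a) f by exact: clinE.
change (Psi (ract (D' Xi) a) = Psi (bidual_act Xi (D a)) + Xi (lact a g)).
rewrite lactE -[Xi _]/((Xi ** to_bidual a) g).
rewrite -gE -linearD; congr (Psi _); apply: clinE => c.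
change (Xi (D (a ** c)) =
  Xi (ract (D a) c) + Xi (bidual_act (to_bidual a) (D c))).
by rewrite dD linearD lactE.
Qed.

(** Representing [D''] at [Phi] by [k] allows [Psi], then [Phi], to be taken outermost; inside
    remains cyclicity of [D] itself. *)
Lemma cyclic_bitranspose : cyclic_operator D -> cyclic_operator D''.
Proof.
move=> cD Phi Psi; have [k kE] := weakly_compact_bidual wD Phi.
change (Phi (D' Psi) + Psi (D' Phi) = 0).
rewrite kE -linearD (_ : k + _ = 0) ?linear0//; apply: clinE => x.
change (to_bidual x k + Phi (D x) = 0); rewrite -kE -linearD.
by rewrite (_ : _ + _ = 0) ?linear0//; apply: clinE => a; exact: cD.
Qed.

End second_arens.

(** * The uniform boundedness principle *)

Section uniform_boundedness.
Variables (R : realType) (b : bool).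
Local Notation K := (scalar_field R b).
Variables (V : completeNormedModType K) (W : normedModType K).

(** If [u] in the unit ball nearly norms [T], one of [y + r u] and [y - r u] works, because
    [2 T (r u) = T (y + r u) - T (y - r u)]. *)
Lemma opnorm_ball (T : clin V W) (y : V) (r : K) : 0 <= r ->
  exists2 z, `|z - y| <= r & 3 / 4 * r * opnorm T <= `|T z|.
Proof.
move=> r0.
(* A constant below 1 is reached by some [u]; it must also exceed the 1/2 lost to the tail in the
   gliding hump. *)
have c0 : 0 <= 3 / 4 :> K by rewrite divr_ge0 ?ler0n.
have [u u1 Tu] : exists2 u, `|u| <= 1 & 3 / 4 * opnorm T <= `|T u|.
  apply: contrapT => hn.
  have T34 : opnorm T <= 3 / 4 * opnorm T.
    apply: opnorm_le => [|x]; first by rewrite mulr_ge0 ?opnorm_ge0.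
    have [->|x0] := eqVneq x 0; first by rewrite linear0 !normr0 mulr0.
    have nx0 : 0 < `|x| by rewrite normr_gt0.
    rewrite -ler_pdivrMr// real_leNgt ?ger0_real ?divr_ge0 ?(mulr_ge0 c0)//;
      last exact: opnorm_ge0.
    apply/negP => h; apply: hn; exists (`|x|^-1 *: x).
      by rewrite normrZ normfV normr_id mulVf ?gt_eqF.
    by rewrite linearZ normrZ normfV normr_id [leRHS]mulrC ltW.
  have T0 : opnorm T = 0.
    apply/eqP; rewrite eq_le opnorm_ge0 andbT.
    move: T34; rewrite -subr_ge0 -{2}[opnorm T]mul1r -mulrBl.
    rewrite (_ : 3 / 4 - 1 = - 4^-1 :> K); last by field.
    by rewrite mulNr oppr_ge0 pmulr_rle0 ?invr_gt0 ?ltr0n.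
  by apply: hn; exists 0; rewrite ?normr0 ?ler01// T0 mulr0.
have [yr|yr] := boolP (`|T (r *: u)| <= `|T (y + r *: u)|).
  exists (y + r *: u).
    by rewrite addrC addKr normrZ ger0_norm// -[leRHS]mulr1 ler_wpM2l.
  apply: le_trans yr; rewrite linearZ normrZ ger0_norm// mulrAC mulrC.
  by rewrite ler_wpM2l.
exists (y - r *: u).
  by rewrite addrC addKr normrN normrZ ger0_norm// -[leRHS]mulr1 ler_wpM2l.
apply: (@le_trans _ _ `|T (r *: u)|).
  by rewrite linearZ normrZ ger0_norm// mulrAC mulrC ler_wpM2l.
move: yr; rewrite -real_ltNge ?ger0_real// => yr.
rewrite -(lerD2l `|T (r *: u)|).
apply: (@le_trans _ _ (`|T (y + r *: u)| + `|T (y - r *: u)|)).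
  rewrite (le_trans _ (ler_normB _ _))// -linearB.
  rewrite opprB (addrC y) addrACA subrr addr0 linearD.
  by rewrite -[X in _ <= `|X|]mulr2n normrMn mulr2n.
by rewrite lerD2r ltW.
Qed.

(* Gliding hump: |x_(n+1) - x_n| <= 3^-n and T_n is nearly extremal at x_(n+1),
   while the remaining steps are too short to spoil this at the limit. *)
Lemma uniform_boundedness (I : Type) (T : I -> clin V W) :
  (forall x, exists M : K, forall i, `|T i x| <= M) ->
  exists2 M : K, 0 <= M & forall i, opnorm (T i) <= M.
Proof.
move=> Tpt; apply: contrapT => Tunb.
have q30 : 3 != 0 :> K by rewrite pnatr_eq0.
pose q : K := 3^-1.
have q0 n : 0 < q ^+ n by rewrite exprn_gt0// invr_gt0 ltr0n.
(* The factor 4 offsets the quarter of [q ^+ n * opnorm (T i)] that survives at the limit point. *)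
have /choice[i_ iP] : forall n : nat, exists i,
    4 * n%:R <= q ^+ n * opnorm (T i).
  move=> n; apply: contrapT => hn; apply: Tunb.
  exists (4 * n%:R / q ^+ n).
    by rewrite divr_ge0 ?mulr_ge0 ?ler0n// ltW.
  move=> i; rewrite ler_pdivlMr// mulrC.
  rewrite real_leNgt ?ger0_real ?mulr_ge0 ?ler0n ?opnorm_ge0// ?(ltW (q0 n))//.
  by apply/negP => h; apply: hn; exists i; exact: ltW.
have /choice[step stepP] : forall ny : nat * V, exists z,
    `|z - ny.2| <= q ^+ ny.1 /\
    3 / 4 * q ^+ ny.1 * opnorm (T (i_ ny.1)) <= `|T (i_ ny.1) z|.
  by move=> [n y]; have [z] := opnorm_ball (T (i_ n)) y (ltW (q0 n)); exists z.
pose x := fix x n := if n is m.+1 then step (m, x m) else 0 : V.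
have xS n : `|x n.+1 - x n| <= q ^+ n by exact: (stepP (n, x n)).1.
have TxS n : 3 / 4 * q ^+ n * opnorm (T (i_ n)) <= `|T (i_ n) (x n.+1)|.
  exact: (stepP (n, x n)).2.
(* Geometric series of ratio 1/3, whence [3/2 = 1 / (1 - 1/3)]. *)
have xD n j : `|x (n + j)%N - x n| <= 3 / 2 * (q ^+ n - q ^+ (n + j)).
  elim: j => [|j ih]; first by rewrite addn0 !subrr normr0 mulr0.
  rewrite addnS (le_trans (ler_distD (x (n + j)%N) _ _))//.
  rewrite (le_trans (lerD (xS _) ih))//.
  rewrite (_ : _ + _ = 3 / 2 * (q ^+ n - q ^+ (n + j).+1))// exprS /q.
  by field; rewrite ?pnatr_eq0.
have xle n m : (n <= m)%N -> `|x m - x n| <= 3 / 2 * q ^+ n.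
  move=> nm; rewrite -(subnKC nm) (le_trans (xD _ _))//.
  by rewrite ler_wpM2l ?divr_ge0 ?ler0n// gerBl ltW.
have small (e : K) : 0 < e -> exists n, 3 / 2 * q ^+ n < e.
  move=> e0; have [|n ne] := @scalar_archi R b (3 / 2 / e).
    by rewrite !divr_ge0 ?ler0n// ltW.
  exists n; rewrite exprVn ltr_pdivrMr ?exprn_gt0 ?ltr0n//.
  rewrite [ltRHS]mulrC -ltr_pdivrMr//.
  by rewrite (lt_trans ne)// -natrX ltr_nat ltn_expl.
have : cvg (x @ \oo).
  apply: cauchy_cvg; apply/cauchyP => e e0; have [n ne] := small e e0.
  exists (x n), n => // m /= nm; rewrite -ball_normE /= distrC.
  exact: le_lt_trans (xle _ _ nm) ne.
move=> /cvg_ex[l xl].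
have ln n : `|l - x n| <= 3 / 2 * q ^+ n.
  apply/ler_addgt0Pr => e e0.
  have /cvgrPdist_lt/(_ e e0)[N _ hN] := xl.
  rewrite (le_trans (ler_distD (x (maxn n N)) _ _))// addrC lerD//.
    by rewrite xle// leq_maxl.
  by apply/ltW/hN; rewrite /= leq_maxr.
have [M TM] := Tpt l.
have [|n nM] := @scalar_archi R b M.
  exact: le_trans (normr_ge0 _) (TM (i_ 0%N)).
suff : n%:R <= M by move/le_gtF; rewrite nM.
apply: le_trans (TM (i_ n)); set Ti := T (i_ n).
have n4 : 0 < 4 :> K by rewrite ltr0n.
rewrite -(ler_pM2l n4); apply: (le_trans (iP n)).
(* Here [3/2 * q ^+ n.+1] is half of [q ^+ n], so [Ti l] retains the fraction [3/4 - 1/2 = 1/4]. *)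
have Tlx : `|Ti (x n.+1)| - `|Ti l| <= opnorm Ti * (3 / 2 * q ^+ n.+1).
  rewrite (le_trans (lerB_dist _ _))// -linearB (le_trans (opnorm_ge _ _))//.
  by rewrite ler_wpM2l ?opnorm_ge0// distrC ln.
have := lerB (TxS n) Tlx; rewrite opprB addrCA subrr addr0 => h.
apply: le_trans (ler_wpM2l (ltW n4) h); rewrite le_eqVlt; apply/orP; left.
by apply/eqP; rewrite -/Ti exprS /q; field; rewrite ?pnatr_eq0.
Qed.

End uniform_boundedness.

(** * Automatic continuity of cyclic operators *)

Section cyclic.
Variables (R : realType) (b : bool).
Local Notation K := (scalar_field R b).
Variable A : banachAlgType K.

(** Uniform boundedness is applied to the functionals [D u], [u] in the unit ball: at [x], cyclicity
    bounds them by the norm of [D x]. *)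
Lemma cyclic_operator_bounded (D : {linear A -> dual A}) :
  cyclic_operator D -> exists2 M : K, 0 <= M & forall a, `|D a| <= M * `|a|.
Proof.
move=> cD; pose T (u : {u : A | `|u| <= 1}) : clin A K^o := D (sval u).
have Dsym a c : `|D a c| = `|D c a|.
  by have /eqP := cD a c; rewrite addr_eq0 => /eqP ->; rewrite normrN.
have [|M M0 TM] := @uniform_boundedness R b A K^o _ T.
  move=> x; exists `|D x| => -[u u1]; rewrite /T /= Dsym.
  by rewrite (le_trans (dual_norm_le _ _))// -[leRHS]mulr1 ler_wpM2l.
exists M => // a; have [->|a0] := eqVneq a 0.
  by rewrite linear0 !normr0 mulr0.
have na0 : 0 < `|a| by rewrite normr_gt0.
have u1 : `| `|a|^-1 *: a| <= 1.
  by rewrite normrZ normfV normr_id mulVf ?gt_eqF.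
have := TM (exist (fun u : A => `|u| <= 1) _ u1).
rewrite /T /= linearZ /= opnormZ.
by rewrite normfV normr_id mulrC ler_pdivrMr.
Qed.

End cyclic.

Theorem proposition5p1 (R : realType) (cplx : bool)
    (A : banachAlgType (scalar_field R cplx))
    (hwc : forall D : clin A (dual A), derivation D -> weakly_compact D) :
  [/\ forall D : clin A (dual A),
        derivation D /\ cyclic_operator D <->
        derivation (transpose (transpose D)) /\
        cyclic_operator (transpose (transpose D)),
      cyclically_weakly_amenable (dual (dual A)) ->
        cyclically_weakly_amenable A &
      unital A -> commutative_alg A ->
        cyclically_amenable (dual (dual A)) -> cyclically_amenable A].
Proof.
split.
- move=> D; split=> [[dD cD]|[dD cD]].
    have wD := hwc D dD.
    by split; [exact: derivation_bitranspose|exact: cyclic_bitranspose].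
  by split; [exact: derivation_bitranspose_inv|exact: cyclic_bitranspose_inv].
- move=> cwaA D dD; apply: cyclic_bitranspose_inv; apply: cwaA.
  exact: derivation_bitranspose dD (hwc D dD).
- move=> _ commA caA D dD cD.
  have [M M0 DM] := cyclic_operator_bounded cD.
  pose Dc : clin A (dual A) := bounded_clin M0 (linearP D) DM.
  have dDc : derivation Dc by exact: dD.
  have wDc := hwc Dc dDc.
  have dDc'' := derivation_bitranspose dDc wDc.
  have [|F DF] := caA (transpose (transpose Dc)) dDc''.
    exact: cyclic_bitranspose.
  (* [D] itself turns out to vanish, so 0 is a witness; [F] lives on the second dual and serves only
     to show this. *)
  exists 0 => a; apply: clinE => c.
  change (transpose (transpose Dc) (to_bidual a) (to_bidual c) = 0 - 0).
  rewrite DF subrr.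
  change (F (to_bidual a ** to_bidual c) - F (to_bidual c ** to_bidual a) = 0).
  by rewrite !to_bidualM (commA a) subrr.
Qed.
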